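(* Consider the double input-double output Mix with arrival rates $\lambda_R>\lambda_B$ and strict delay constraint $T$, as described in the context. Consider the following strategy. In each slot (after arrivals), whenever both the red queue and the blue queue are non-empty, transmit the head-of-the-line (HOL) packet of each queue, simultaneously, at their corresponding output links. If a HOL packet has been in its queue for more than $T$ time slots and there has been no arrival in the other queue with which it could be transmitted, drop it. Otherwise transmit nothing. This strategy is optimal in the sense that it yields perfect anonymity with maximum possible throughput: it has anonymity $A^\psi=1$, and the throughput of each flow under it is at least the throughput of that flow under any strategy that satisfies the delay constraint $T$ and has perfect anonymity.
   Context: **Model.** Time is slotted. A Mix has two input links and two output links, each of capacity 1 packet/slot. In each slot a red packet arrives with probability $\lambda_R$ and a blue packet arrives with probability $\lambda_B$, independently of each other and across slots. Within each slot, arrivals occur first and then departures. Red and blue packets are stored in two separate queues (first-in first-out), initially empty. All red packets must leave through output link $d_R\in\{1,2\}$ and all blue packets through the other output link; $d_R$ is uniformly distributed on $\{1,2\}$ and independent of the arrivals. The Mix may drop packets, and its (possibly randomized) decisions are causal. **Strict delay constraint $T$** ($T\ge 0$ an integer): every packet that arrives in slot $a$ must either be transmitted in one of the slots $a,a+1,\dots,a+T$ or be dropped. **Anonymity.** Let $I_R^{(N)}$, $I_B^{(N)}$ be the sequences of red and blue arrivals in the first $N$ slots, and let $G_i^{(N)}=(G_i(1),\dots,G_i(N))$, $i=1,2$, where $G_i(t)\in\{0,1\}$ indicates whether a packet is transmitted on output $i$ in slot $t$. The anonymity of a strategy $\psi$ is $$A^\psi=\lim_{N\to\infty}H\big(d_R\mid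 I_R^{(N)},I_B^{(N)},G_1^{(N)},G_2^{(N)}\big)$$ (Shannon conditional entropy in bits). Perfect anonymity means $A^\psi=1$. **Throughput** of a flow: the long-run average number of packets of that flow transmitted per slot. *)

(* Defs.v *)
(* MathComp-Analysis. *)
From HB Require Import structures.
From mathcomp Require Import all_boot all_order all_algebra.
From mathcomp Require Import all_classical all_reals all_analysis.
Set Implicit Arguments.
Unset Strict Implicit.
Unset Printing Implicit Defensive.
Import Order.TTheory GRing.Theory Num.Theory.
Import numFieldNormedType.Exports.
Local Open Scope classical_set_scope.
Local Open Scope ring_scope.

Variant flow := Red | Blue.

Variant link := Link1 | Link2.

Definition bool_of_link (i : link) : bool := if i is Link1 then true else false.
Definition link_of_bool (b : bool) : link := if b then Link1 else Link2.
Lemma bool_of_linkK : cancel bool_of_link link_of_bool.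
Proof. by case. Qed.
HB.instance Definition _ := Finite.copy link (can_type bool_of_linkK).

(* Slots are numbered from 0.  At most one packet per flow arrives in a slot, so
   a packet is identified by its flow and its arrival slot; a queue is the list
   of the arrival slots of its packets, head of the line first. *)

(* The packets listed in [drops] are removed from the queue first; then, if
   [send] holds, the head of what is left (if any) is transmitted. *)
Record decision := Decision { drops : seq nat; send : bool }.

(* [f l h qR qB c] is the decision taken for flow [c] when the red packets must
   leave through link [l], [h] lists the (red, blue) arrival indicators of all
   slots up to and including the current one, and [qR], [qB] are the contents of
   the two queues after the arrivals of the current slot. *)
Definition rule := link -> seq (bool * bool) -> seq nat -> seq nat -> flow -> decision.

Definition kept (D : decision) (q : seq nat) : seq nat :=
  [seq a <- q | a \notin drops D].

Definition departing (D : decision) (q : seq nat) : option nat :=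
  if send D then ohead (kept D q) else None.

Definition remaining (D : decision) (q : seq nat) : seq nat :=
  if send D then behead (kept D q) else kept D q.

(* [w c t] tells whether a packet of flow [c] arrives in slot [t]. *)
Definition history (w : flow -> nat -> bool) (t : nat) : seq (bool * bool) :=
  [seq (w Red s, w Blue s) | s <- iota 0 t.+1].

Definition arrive (w : flow -> nat -> bool) (t : nat) (q : flow -> seq nat)
    (c : flow) : seq nat :=
  if w c t then rcons (q c) t else q c.

Definition act (f : rule) (l : link) (w : flow -> nat -> bool) (t : nat)
    (q : flow -> seq nat) : flow -> decision :=
  f l (history w t) (q Red) (q Blue).

(* Queues at the beginning of slot [t], before its arrivals. *)
Fixpoint backlog (f : rule) (l : link) (w : flow -> nat -> bool) (t : nat) :
    flow -> seq nat :=
  if t is s.+1 then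
    let q := arrive w s (backlog f l w s) in
    fun c => remaining (act f l w s q c) (q c)
  else fun=> [::].

Definition waiting (f : rule) (l : link) (w : flow -> nat -> bool) (t : nat) :
    flow -> seq nat :=
  arrive w t (backlog f l w t).

Definition sent (f : rule) (l : link) (w : flow -> nat -> bool) (c : flow)
    (t : nat) : option nat :=
  departing (act f l w t (waiting f l w t) c) (waiting f l w t c).

Definition dropped (f : rule) (l : link) (w : flow -> nat -> bool) (c : flow)
    (t a : nat) : bool :=
  (a \in waiting f l w t c) && (a \in drops (act f l w t (waiting f l w t) c)).

Definition respects_delay (T : nat) (f : rule) (l : link)
    (w : flow -> nat -> bool) : Prop :=
  forall (c : flow) (a : nat), w c a ->
    (exists t, (a <= t <= a + T)%N /\ sent f l w c t = Some a) \/
    (exists t, dropped f l w c t a).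

Definition flow_on (l i : link) : flow := if i == l then Red else Blue.

Definition output (f : rule) (l : link) (w : flow -> nat -> bool) (i : link)
    (t : nat) : bool :=
  isSome (sent f l w (flow_on l i) t).

(* A packet that arrived in slot [a] and has not left by the end of slot [t] has
   been in its queue for the [t.+1 - a] slots [a], ..., [t]. *)
Definition matching_rule (T : nat) : rule := fun l h qR qB c =>
  let t := (size h).-1 in
  match qR, qB with
  | _ :: _, _ :: _ => Decision [::] true
  | _, _ =>
      if (if c is Red then qR else qB) is a :: _ then
        if (T < t.+1 - a)%N then Decision [:: a] false else Decision [::] false
      else Decision [::] false
  end.

(* A randomized strategy is a rule depending on a random seed; the seed may have
   any distribution but is independent of the arrivals and of the destination. *)
Definition measurable_strategy d (S : measurableType d) (psi : S -> rule) : Prop :=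
  forall l h qR qB c (D : decision),
    measurable [set s | psi s l h qR qB c = D].

Record mix_inputs (Omega S : Type) := MixInputs {
  arrival : flow -> nat -> Omega -> bool;
  red_link : Omega -> link;
  seed : Omega -> S
}.

Variant source := Arrival of flow & nat | Destination | Seed.

Definition source_events (Omega : Type) d (S : measurableType d)
    (X : mix_inputs Omega S) (i : source) : set (set Omega) :=
  match i with
  | Arrival c t => [set arrival X c t @^-1` B | B in [set: set bool]]
  | Destination => [set red_link X @^-1` B | B in [set: set link]]
  | Seed => [set seed X @^-1` B | B in measurable]
  end.

Definition mutually_independent d (Omega : measurableType d) (R : realType)
    (P : probability Omega R) (I : Type) (F : I -> set (set Omega)) : Prop :=
  forall (n : nat) (i : 'I_n -> I), injective i ->
  forall E : 'I_n -> set Omega, (forall k, F (i k) (E k)) ->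
    P (\bigcap_k E k) = (\prod_(k < n) P (E k))%E.

Record mix_model d (Omega : measurableType d) (R : realType)
    (P : probability Omega R) (lambda : flow -> R) d' (S : measurableType d')
    (X : mix_inputs Omega S) : Prop := MixModel {
  source_measurable : forall i, source_events X i `<=` measurable;
  source_independent : mutually_independent P (source_events X);
  arrival_rate : forall c t, P [set x | arrival X c t x] = (lambda c)%:E;
  red_link_uniform : forall i, P [set x | red_link X x = i] = (2^-1)%:E
}.

Definition log2 (R : realType) (x : R) : R := ln x / ln 2.

(* H(A | B) = - sum_{a, b} p(a, b) log2 (p(a, b) / p(b)). *)
Definition cond_entropy d (Omega : measurableType d) (R : realType)
    (P : probability Omega R) (TA TB : finType) (A : Omega -> TA)
    (B : Omega -> TB) : R :=
  - \sum_(b : TB) \sum_(a : TA)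
      let pab := fine (P [set x | A x = a /\ B x = b]) in
      let pb := fine (P [set x | B x = b]) in
      pab * log2 (pab / pb).

Section Strategy.
Context d (Omega : measurableType d) (R : realType) (P : probability Omega R).
Context (S : Type) (X : mix_inputs Omega S) (psi : S -> rule).

Definition realised (x : Omega) (c : flow) (t : nat) : bool := arrival X c t x.

Definition transmits (c : flow) (t : nat) (x : Omega) : bool :=
  isSome (sent (psi (seed X x)) (red_link X x) (realised x) c t).

Definition observation (N : nat) (x : Omega) :
    ((N.-tuple bool * N.-tuple bool) * (N.-tuple bool * N.-tuple bool))%type :=
  let G := output (psi (seed X x)) (red_link X x) (realised x) in
  (([tuple arrival X Red t x | t < N], [tuple arrival X Blue t x | t < N]),
   ([tuple G Link1 t | t < N], [tuple G Link2 t | t < N])).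

Definition has_anonymity (A : R) : Prop :=
  cond_entropy P (red_link X) (observation N) @[N --> \oo] --> A.

Definition mean_output (c : flow) (N : nat) : \bar R :=
  'E_P[fun x => (\sum_(t < N) (transmits c t x)%:R) / N%:R].

(* The upper limit makes the throughput defined for every strategy. *)
Definition throughput (c : flow) : \bar R := limn_esup (mean_output c).

Definition meets_delay (T : nat) : Prop :=
  {ae P, forall x,
    respects_delay T (psi (seed X x)) (red_link X x) (realised x)}.

End Strategy.

(* Main.v *)
Require Import Defs.
From mathcomp Require Import all_boot all_order all_algebra.
From mathcomp Require Import all_classical all_reals all_analysis.
From mathcomp Require Import measurable_realfun zify ring lra.
Import Order.TTheory GRing.Theory Num.Theory.
Import numFieldNormedType.Exports.
Local Open Scope classical_set_scope.
Local Open Scope ring_scope.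
Set Implicit Arguments.
Unset Strict Implicit.
Unset Printing Implicit Defensive.

(* Revealing more outputs can only decrease the conditional entropy, so
   anonymity 1 forces H = 1 for every horizon N: given the arrivals and the
   outputs up to N, both values of d_R are equally likely.  An observation of
   positive probability is therefore realised under both values of d_R, and the
   transmission times on either output link form a feasible schedule (within
   the delay T) for the red arrivals as well as for the blue ones.  Such a
   schedule matches red with blue packets whose arrival slots differ by at most
   T, and by an exchange argument no matching is larger than the one that the
   HOL rule builds online.  Hence the rule dominates, pathwise and for every N,
   all perfectly anonymous strategies.  The same maximality makes the number of
   pairs superadditive in N, so its mean rate converges by Fekete's lemma. *)

(** * Queues *)

Section Queues.
Variables (f : rule) (l : link) (w : flow -> nat -> bool).

Lemma kept_subseq D q : subseq (kept D q) q.
Proof. exact: filter_subseq. Qed.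

Lemma remaining_subseq D q : subseq (remaining D q) q.
Proof.
rewrite /remaining; case: ifP => _; last exact: kept_subseq.
apply: subseq_trans (kept_subseq D q).
by case: (kept D q) => //= a k; exact: subseq_cons.
Qed.

Lemma arriveP t c (q : flow -> seq nat) : sorted ltn (q c) ->
  (forall a, a \in q c -> (a < t)%N /\ w c a) ->
  sorted ltn (arrive w t q c) /\
    forall a, a \in arrive w t q c -> (a <= t)%N /\ w c a.
Proof.
move=> srt mem; rewrite /arrive; case: ifP => wct; last first.
  by split=> // a /mem[at_ wa]; split=> //; exact: ltnW.
split.
  case: (q c) srt mem => //= a k srt mem.
  rewrite rcons_path srt /=.
  by apply: (mem _ _).1; exact: mem_last.
move=> a; rewrite mem_rcons inE => /predU1P[->//|/mem[at_ wa]].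
by split=> //; exact: ltnW.
Qed.

(** Arrivals append the current slot and decisions only remove entries, so each queue stays
    increasing. Hence its head is the oldest packet and no packet occurs twice. *)
Lemma backlogP t c : sorted ltn (backlog f l w t c) /\
  forall a, a \in backlog f l w t c -> (a < t)%N /\ w c a.
Proof.
elim: t c => [|t IH] c; first by split.
have [srt mem] := IH c; have [qsrt qmem] := arriveP srt mem.
set q := arrive w t _ in qsrt qmem.
have sub := remaining_subseq (act f l w t q c) (q c).
split=> /=; first exact: (subseq_sorted ltn_trans sub).
by move=> a /(mem_subseq sub)/qmem.
Qed.

Lemma waitingP t c : sorted ltn (waiting f l w t c) /\
  forall a, a \in waiting f l w t c -> (a <= t)%N /\ w c a.
Proof. by have [srt mem] := backlogP t c; exact: arriveP. Qed.

Lemma waiting_uniq t c : uniq (waiting f l w t c).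
Proof. exact: (sorted_uniq ltn_trans ltnn (waitingP t c).1). Qed.

Lemma mem_waiting t c a : (a \in waiting f l w t c) =
  ((a == t) && w c t) || (a \in backlog f l w t c).
Proof.
by rewrite /waiting /arrive; case: ifP => _; rewrite ?mem_rcons ?inE ?andbT ?andbF.
Qed.

Lemma mem_backlogS t c a : a \in backlog f l w t.+1 c -> a \in waiting f l w t c.
Proof. by move/(mem_subseq (remaining_subseq _ _)). Qed.

(** A packet enters its queue only in its own arrival slot, so once it is absent after that slot it
    never returns. *)
Lemma backlog_gone t s c a : (a <= t)%N -> a \notin backlog f l w t.+1 c ->
  (t < s)%N -> a \notin backlog f l w s c.
Proof.
move=> le_at gone; elim: s => // s IH; rewrite ltnS leq_eqVlt => /predU1P[<-//|lt_ts].
apply/negP => /mem_backlogS; rewrite mem_waiting (negPf (IH lt_ts)) orbF.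
by case/andP => /eqP eq_as; rewrite ltnNge -eq_as le_at in lt_ts.
Qed.

Lemma sent_waiting c t a : sent f l w c t = Some a ->
  [/\ a \in waiting f l w t c, a \notin backlog f l w t.+1 c &
      ~~ dropped f l w c t a].
Proof.
rewrite /sent /departing /dropped /=; set D := act _ _ _ _ _ _.
rewrite -[arrive w t _]/(waiting f l w t); have := waiting_uniq t c.
move: (waiting _ _ _ _ _) => q uq; rewrite /remaining.
case: (send D) => //; have := filter_uniq (fun a => a \notin drops D) uq.
have : forall x, x \in kept D q -> (x \in q) && (x \notin drops D).
  by move=> x; rewrite mem_filter andbC.
rewrite -/(kept D q); case: (kept D q) => // b k kq /= /andP[bk _] [<-].
by have /andP[-> ->] := kq b (mem_head _ _).
Qed.

Lemma waiting_fate c t a : a \in waiting f l w t c ->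
  [\/ a \in backlog f l w t.+1 c, sent f l w c t = Some a | dropped f l w c t a].
Proof.
move=> qa; rewrite /dropped qa /= /sent /departing.
set D := act _ _ _ _ _ _; rewrite -/(waiting f l w t) -/D /remaining.
case: (boolP (a \in drops D)) => [_|nda]; first by constructor 3.
have : a \in kept D (waiting f l w t c) by rewrite mem_filter nda.
case: (send D); last by move=> ?; constructor 1.
by case: (kept _ _) => //= b k; rewrite inE => /predU1P[->|]; [constructor 2 | constructor 1].
Qed.

(** Taken at [t = a + T], this yields the delay constraint of the matching rule once the first
    alternative is excluded there. *)
Lemma packet_fate c t a : w c a -> (a <= t)%N ->
  [\/ a \in backlog f l w t.+1 c,
      exists2 s, (a <= s)%N & sent f l w c s = Some a |
      exists s, dropped f l w c s a].
Proof.
move=> wa; elim: t => [|t IH].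
  rewrite leqn0 => /eqP a0; rewrite a0 in wa *.
  have : 0%N \in waiting f l w 0 c by rewrite mem_waiting wa.
  by case/waiting_fate; [constructor 1 | constructor 2; exists 0%N | constructor 3; exists 0%N].
move=> le_at.
have [qa|] : a \in waiting f l w t.+1 c \/ [\/ a \in backlog f l w t.+1 c,
      exists2 s, (a <= s)%N & sent f l w c s = Some a |
      exists s, dropped f l w c s a].
  move: le_at; rewrite leq_eqVlt => /predU1P[eq_at|/IH]; last by right.
  by left; rewrite mem_waiting eq_at eqxx -eq_at wa.
  by case/waiting_fate: qa; [constructor 1 | constructor 2; exists t.+1 | constructor 3; exists t.+1].
case=> [qa|ex|ex]; [|by constructor 2|by constructor 3].
have {}qa : a \in waiting f l w t.+1 c by rewrite mem_waiting qa orbT.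
by case/waiting_fate: qa; [constructor 1 | constructor 2; exists t.+1 | constructor 3; exists t.+1].
Qed.

Lemma sent_gone c t s a : sent f l w c t = Some a -> (t < s)%N ->
  a \notin waiting f l w s c.
Proof.
move=> /sent_waiting[qa gone _] lt_ts.
have [le_at _] := (waitingP t c).2 _ qa.
rewrite mem_waiting negb_or (backlog_gone le_at gone lt_ts) andbT.
by rewrite (ltn_eqF (leq_ltn_trans le_at lt_ts)).
Qed.

Lemma sent_inj c t s a : sent f l w c t = Some a -> sent f l w c s = Some a -> t = s.
Proof.
move=> ta sa; case: (ltngtP t s) => // lt.
  by have := sent_gone ta lt; case/sent_waiting: sa => ->.
by have := sent_gone sa lt; case/sent_waiting: ta => ->.
Qed.

Lemma sent_not_dropped c t s a : sent f l w c t = Some a -> ~~ dropped f l w c s a.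
Proof.
move=> ta; apply/negP => sd; case: (ltngtP t s) => lt.
- by have := sent_gone ta lt; case/andP: sd => ->.
(* A drop in a slot [s < t] removes [a] for good, so [a] could not be in the queue when it is sent
   in slot [t]. *)
- have [] := andP sd => qa da.
  have [le_as _] := (waitingP s c).2 _ qa.
  have gone : a \notin backlog f l w s.+1 c.
    apply/negP => /=; rewrite -/(waiting f l w s) /remaining => ra.
    have : a \in kept (act f l w s (waiting f l w s) c) (waiting f l w s c).
      by case: (send _) ra => //; exact: mem_behead.
    by rewrite mem_filter da.
  case/sent_waiting: ta; rewrite mem_waiting (negPf (backlog_gone le_as gone lt)) orbF.
  by case/andP => /eqP at_; rewrite ltnNge -at_ le_as in lt.
- by case/sent_waiting: ta; rewrite lt sd.
Qed.

Lemma sent_in_time T c t a : respects_delay T f l w -> sent f l w c t = Some a ->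
  [/\ w c a, (a <= t)%N & (t <= a + T)%N].
Proof.
move=> delay ta; have [qa _ _] := sent_waiting ta.
have [le_at wa] := (waitingP t c).2 _ qa; split=> //.
case: (delay c a wa) => [[s [/andP[_ sT] sa]]|[s]].
  by rewrite (sent_inj ta sa).
by rewrite (negPf (sent_not_dropped s ta)).
Qed.

End Queues.

(** * Causality: dependence on past arrivals only *)

Lemma history_local w w' t : (forall c s, (s <= t)%N -> w c s = w' c s) ->
  history w t = history w' t.
Proof.
move=> eqw; apply/eq_in_map => s; rewrite mem_iota add0n => /andP[_ st].
by rewrite !eqw.
Qed.

Lemma backlog_local f l w w' t c : (forall c s, (s < t)%N -> w c s = w' c s) ->
  backlog f l w t c = backlog f l w' t c.
Proof.
elim: t c => // t IH c eqw /=.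
have eqa d : arrive w t (backlog f l w t) d = arrive w' t (backlog f l w' t) d.
  by rewrite /arrive eqw // IH // => e s st; apply: eqw; exact: ltnW.
by rewrite /act !eqa (history_local eqw).
Qed.

Lemma sent_local f l w w' t c : (forall c s, (s <= t)%N -> w c s = w' c s) ->
  sent f l w c t = sent f l w' c t.
Proof.
move=> eqw; have eqa d : waiting f l w t d = waiting f l w' t d.
  rewrite /waiting /arrive eqw // (@backlog_local _ _ w w') // => e s st.
  by rewrite eqw // ltnW.
by rewrite /sent /act !eqa (history_local eqw).
Qed.

(** * The matching rule is optimal *)

Section Matching.
Variables (T : nat) (l : link) (w : flow -> nat -> bool).
Local Notation W := (waiting (matching_rule T) l w).
Local Notation Q := (backlog (matching_rule T) l w).

Definition paired (t : nat) : bool := (W t Red != [::]) && (W t Blue != [::]).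

Lemma size_history t : size (history w t) = t.+1.
Proof. by rewrite size_map size_iota. Qed.

(** The expiry test takes the form [a + T <= t]: an unmatched head leaves at the end of slot
    [a + T], the last one in which it may be sent. *)
Lemma matching_act t c : act (matching_rule T) l w t (W t) c =
  if paired t then Decision [::] true else
  if W t c is a :: _ then
    if (a + T <= t)%N then Decision [:: a] false else Decision [::] false
  else Decision [::] false.
Proof.
have fW d a k : W t d = a :: k -> (T < t.+1 - a)%N = (a + T <= t)%N.
  move=> eqW; have [le_at _] : (a <= t)%N /\ w d a.
    by apply: (waitingP (matching_rule T) l w t d).2; rewrite eqW mem_head.
  lia.
rewrite /act /matching_rule size_history /paired.
case eqR: (W t Red) => [|r qr]; case eqB: (W t Blue) => [|b qb] //=;
  by case: c => /=; rewrite ?eqR ?eqB //; rewrite ?(fW _ _ _ eqR) ?(fW _ _ _ eqB).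
Qed.

Lemma kept_nil s q : kept (Decision [::] s) q = q.
Proof. by apply/all_filterP/allP. Qed.

Lemma matching_sent c t : sent (matching_rule T) l w c t =
  if paired t then ohead (W t c) else None.
Proof.
rewrite /sent matching_act; case: ifP => [_|_]; first by rewrite /departing kept_nil.
by case: (W t c) => //= a k; case: ifP.
Qed.

Lemma matching_sent_some c t : isSome (sent (matching_rule T) l w c t) = paired t.
Proof.
rewrite matching_sent; case: ifP => //; rewrite /paired => /andP[].
by case: c; [case: (W t Red) | case: (W t Blue)] => //= a k _ [].
Qed.

Lemma matching_backlogS t c : Q t.+1 c =
  if paired t then behead (W t c) else
  if W t c is a :: k then if (a + T <= t)%N then k else W t c else [::].
Proof.
have := matching_act t c; rewrite /= -/(W t) => ->.
case: ifP => [_|_]; first by rewrite /remaining kept_nil.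
have := waiting_uniq (matching_rule T) l w t c.
case: (W t c) => //= a k /andP[ak _]; case: ifP => _; rewrite /remaining /=; last first.
  by rewrite kept_nil.
(* The queue has no repeated entries, so filtering out [a] removes the head only. *)
rewrite /kept /= inE eqxx /=; apply/all_filterP/allP => x xk.
by rewrite /= inE; apply: contraNneq ak => <-.
Qed.

(** Testing only the head for expiry suffices: the arrival slots in a queue are strictly increasing,
    so at most the head reaches its deadline in a given slot. *)
Lemma matching_unexpired t c a : a \in W t c -> (t <= a + T)%N.
Proof.
elim: t c a => // t IH c a.
rewrite mem_waiting => /orP[/andP[/eqP-> _]|]; first exact: leq_addr.
have := (waitingP (matching_rule T) l w t c).1.
rewrite matching_backlogS; have := IH c; case: (W t c) => [|b k] {}IH /=.
  by rewrite if_same.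
move=> /(order_path_min ltn_trans)/allP minb ak.
have {}ak : (a \in k) || ((a == b) && (t < b + T)%N).
  move: ak; case: ifP => _; first by move=> ->.
  by case: leqP => _; rewrite ?inE; move=> /= ak; rewrite ?ak // andbT orbC.
case/orP: ak => [/minb /= lt_ba|/andP[/eqP-> //]].
have := IH b (mem_head _ _); lia.
Qed.

(** A queue that is empty before a slot holds at most one packet after the arrivals, and sending a
    pair removes it. If no pair is sent, one of the queues is empty already after the arrivals. *)
Lemma matching_one_queue t : Q t Red = [::] \/ Q t Blue = [::].
Proof.
elim: t => [|t IH]; first by left.
have nil1 c : Q t c = [::] -> behead (W t c) = [::].
  by rewrite /waiting /arrive => ->; case: (w c t).
have nilS c : W t c = [::] -> Q t.+1 c = [::].
  by rewrite matching_backlogS => ->; rewrite if_same.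
case: (boolP (paired t)) => [pt|].
  by case: IH => /nil1 e; [left | right]; rewrite matching_backlogS pt.
by rewrite negb_and !negbK => /orP[]/eqP/nilS; [left | right].
Qed.

Lemma matching_respects_delay : respects_delay T (matching_rule T) l w.
Proof.
move=> c a wa; case: (packet_fate (matching_rule T) l wa (leq_addr T a)) => [qa|[s le_as sa]|ex].
- have : a \in W (a + T).+1 c by rewrite mem_waiting qa orbT.
  by move/matching_unexpired; rewrite ltnn.
- left; exists s; split=> //; rewrite le_as /=.
  by apply: (@matching_unexpired s c); case/sent_waiting: sa.
- by right.
Qed.

End Matching.

(** * Offline schedules, matchings and optimality of the online rule *)

Definition schedulable (T : nat) (v : nat -> bool) (G : seq nat) : Prop :=
  exists2 a : nat -> nat, {in G &, injective a} &
    forall t, t \in G -> [/\ v (a t), (a t <= t)%N & (t <= a t + T)%N].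

Lemma sent_schedulable T f l w c G : respects_delay T f l w ->
  (forall t, t \in G -> isSome (sent f l w c t)) -> schedulable T (w c) G.
Proof.
(* Slot [t] is assigned the packet sent in it; the default [0] never occurs on [G]. *)
move=> delay sG; exists (fun t => odflt 0%N (sent f l w c t)).
  move=> s t /sG + /sG; case es: (sent f l w c s) => [a|] // _.
  case et: (sent f l w c t) => [b|] // _ /= eq_ab; rewrite -eq_ab in et.
  exact: sent_inj es et.
move=> t /sG; case et: (sent f l w c t) => [a|] // _ /=.
exact: sent_in_time delay et.
Qed.

(** [Link1] is an arbitrary choice: by [paired_link] the pairing is the same for both links. *)
Definition matched (T : nat) (w : flow -> nat -> bool) (N : nat) : nat :=
  \sum_(t < N) paired T Link1 w t.

(* The red packet [a i] is matched with the blue packet [b i], for [i] in [I]. *)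
Record delay_matching (T : nat) (I : seq nat) (a b : nat -> nat) : Prop := DelayMatching {
  matching_index : uniq I;
  matching_red : {in I &, injective a};
  matching_blue : {in I &, injective b};
  matching_close : forall i, i \in I -> (a i <= b i + T)%N /\ (b i <= a i + T)%N
}.

(* Exchange: if the oldest packets are matched with [b i] and [a j], then the
   latter two can be matched with each other. *)
Lemma matching_exchange T I a b r0 b0 : delay_matching T I a b ->
  (forall i, i \in I -> r0 <= a i)%N -> (forall i, i \in I -> b0 <= b i)%N ->
  exists J b', [/\ delay_matching T J a b', (size I <= (size J).+1)%N,
    {subset J <= I}, (forall i, i \in J -> a i != r0) &
    (forall i, i \in J -> b' i != b0 /\ exists2 k, k \in I & b' i = b k)].
Proof.
move=> [uI ia ib cl] mina minb.
case: (boolP (has (fun i => a i == r0) I)) => [/hasP[i iI /eqP ai]|/hasPn na]; last first.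
  case: (boolP (has (fun i => b i == b0) I)) => [/hasP[j jI /eqP bj]|/hasPn nb].
    exists (rem j I), b; split.
    + split; first exact: rem_uniq.
      * by move=> x y /mem_rem xI /mem_rem yI; exact: ia.
      * by move=> x y /mem_rem xI /mem_rem yI; exact: ib.
      * by move=> x /mem_rem; exact: cl.
    + by rewrite size_rem //; case: (I) jI.
    + exact: mem_rem.
    + by move=> x /mem_rem; exact: na.
    + move=> x xJ; have xI := mem_rem xJ; split; last by exists x.
      rewrite -bj; apply/eqP => /ib => /(_ xI jI) xj.
      by rewrite xj mem_rem_uniqF in xJ.
  by exists I, b; split=> // i iI; split; [exact: nb | exists i].
have mem_J k : k \in rem i I -> (k \in I) * (k != i).
  by rewrite (mem_rem_uniq _ uI) inE => /andP[-> ->].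
have size_J : (size I <= (size (rem i I)).+1)%N.
  by rewrite size_rem //; case: (I) iI.
have na k : k \in rem i I -> a k != r0.
  by case/mem_J => kI ki; apply: contra ki => /eqP ak; apply/eqP/ia; rewrite // ak.
case: (boolP (has (fun i => b i == b0) I)) => [/hasP[k kI /eqP bk]|/hasPn nb]; last first.
  exists (rem i I), b; split=> //.
  + split; first exact: rem_uniq.
    * by move=> x y /mem_rem xI /mem_rem yI; exact: ia.
    * by move=> x y /mem_rem xI /mem_rem yI; exact: ib.
    * by move=> x /mem_rem; exact: cl.
  + exact: mem_rem.
  + by move=> x /mem_rem xI; split; [exact: nb | exists x].
(* Index [i], which holds [r0], is removed and its blue packet [b i] goes to index [k], which gives
   up [b0]. If [k = i], the redefinition acts outside the new index set. *)
exists (rem i I), (fun x => if x == k then b i else b x); split=> //.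
- split; first exact: rem_uniq.
  + by move=> x y /mem_rem xI /mem_rem yI; exact: ia.
  + move=> x y /mem_J[xI xi] /mem_J[yI yi].
    case: (eqVneq x k) (eqVneq y k) => [->|xk] [->|yk] // /ib.
    * by move/(_ iI yI) => iy; rewrite iy eqxx in yi.
    * by move/(_ xI iI) => xi'; rewrite xi' eqxx in xi.
    * by apply.
  + move=> x /mem_J[xI xi]; case: (eqVneq x k) => [xk|_]; last exact: cl.
    (* The new pair is close: [a k <= b0 + T <= b i + T] and [b i <= r0 + T <= a k + T]. *)
    have := cl _ iI; have := cl _ xI; have := mina _ xI; have := minb _ iI.
    rewrite ai xk bk; lia.
- exact: mem_rem.
- move=> x /mem_J[xI xi]; case: (eqVneq x k) => [xk|xk]; last first.
    by split; [rewrite -bk; apply: contra xk => /eqP/ib-> | exists x].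
  split; last by exists i.
  rewrite -bk; apply: contra xi => /eqP/ib e; rewrite xk; apply/eqP.
  by rewrite e.
Qed.

(** Induction on the number [N - t] of remaining slots, for matchings among packets queued at [t] or
    arriving later. A paired slot costs at most one index, by the exchange; an unpaired slot costs
    none, since the rule drops no packet whose partner is still to come. *)
Lemma matched_optimal_from T w N t I a b : delay_matching T I a b ->
  (forall i, i \in I -> a i \in backlog (matching_rule T) Link1 w t Red \/
    (t <= a i < N)%N /\ w Red (a i)) ->
  (forall i, i \in I -> b i \in backlog (matching_rule T) Link1 w t Blue \/
    (t <= b i < N)%N /\ w Blue (b i)) ->
  (size I <= \sum_(t <= s < N) paired T Link1 w s)%N.
Proof.
have [m] := ubnP (N - t); elim: m t I a b => // m IH t I a b lt_m match_ab Ra Rb.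
have [le_Nt|lt_tN] := leqP N t.
  (* At the horizon both packets of a matched pair would be queued, but one of the queues is
     empty. *)
  case: I match_ab Ra Rb => // i I _ Ra Rb.
  have [|] := Ra i (mem_head _ _); last lia.
  have [|] := Rb i (mem_head _ _); last lia.
  by case: (matching_one_queue T Link1 w t) => ->.
pose W := waiting (matching_rule T) Link1 w t.
pose Q := backlog (matching_rule T) Link1 w.
have toW c x : x \in Q t c \/ (t <= x < N)%N /\ w c x ->
    x \in W c \/ (t < x < N)%N /\ w c x.
  rewrite mem_waiting => -[->|[]]; first by left; rewrite orbT.
  rewrite leq_eqVlt => /andP[/predU1P[->|lt_tx] lt_xN] wx; last by right; rewrite lt_tx.
  by left; rewrite eqxx wx.
have {}Ra i : i \in I -> a i \in W Red \/ (t < a i < N)%N /\ w Red (a i) by move/Ra/toW.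
have {}Rb i : i \in I -> b i \in W Blue \/ (t < b i < N)%N /\ w Blue (b i) by move/Rb/toW.
(* The heads are the oldest packets still available, queued or future, as the exchange requires. *)
have leW c x y k : W c = y :: k -> x \in W c \/ (t < x < N)%N /\ w c x -> (y <= x)%N.
  move=> eqW; have [srt mem] := waitingP (matching_rule T) Link1 w t c.
  rewrite -/W eqW in srt mem *.
  case=> [|[/andP[lt_tx _] _]]; last first.
    by have [le_yt _] := mem y (mem_head _ _); exact: ltnW (leq_ltn_trans le_yt lt_tx).
  rewrite inE => /predU1P[->//|xk].
  by have /allP/(_ x xk)/ltnW := order_path_min ltn_trans srt.
rewrite big_ltn //; case: (boolP (paired T Link1 w t)) => pt.
  have := pt; rewrite /paired -/W.
  case eqR: (W Red) => [|r0 kr] //; case eqB: (W Blue) => [|b0 kb] // _.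
  have [||J [b' [matchJ sizeJ subJ nr nb]]] := @matching_exchange T I a b r0 b0 match_ab.
  - by move=> i /Ra; exact: leW eqR.
  - by move=> i /Rb; exact: leW eqB.
  apply: leq_trans sizeJ _; rewrite ltnS.
  have stepW c x y k : W c = y :: k -> x != y -> x \in W c \/ (t < x < N)%N /\ w c x ->
      x \in Q t.+1 c \/ (t < x < N)%N /\ w c x.
    move=> eqW xy [xW|]; last by right.
    left; rewrite /Q matching_backlogS pt -/W eqW /=.
    by move: xW; rewrite eqW inE (negPf xy).
  apply: (IH t.+1 J a b'); [lia|by []| |].
  - by move=> i iJ; apply: (stepW _ _ _ _ eqR (nr i iJ)); apply/Ra/subJ.
  - by move=> i iJ; have [nbi [k kI eqb]] := nb i iJ; rewrite eqb in nbi *;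
      apply: (stepW _ _ _ _ eqB nbi); apply/Rb.
(* With the partner's queue empty, the partner [y] arrives after [t]; then [t < y <= x + T], so [x]
   is not an expired head and stays queued. *)
have stepU c e x y : W c = [::] \/ W e = [::] -> (y <= x + T)%N ->
    x \in W c \/ (t < x < N)%N /\ w c x -> y \in W e \/ (t < y < N)%N /\ w e y ->
    x \in Q t.+1 c \/ (t < x < N)%N /\ w c x.
  move=> nilW le_yx [xW|]; last by right.
  case: nilW => eqW; first by rewrite eqW in xW.
  rewrite eqW => -[//|[/andP[lt_ty _] _]]; left.
  rewrite /Q matching_backlogS (negPf pt) -/W.
  case: (W c) xW => // z k; rewrite inE => xW; case: ifP => le_zt; last by rewrite inE.
  case/predU1P: xW => // xz; lia.
have nilW : W Red = [::] \/ W Blue = [::].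
  by move: pt; rewrite /paired negb_and !negbK => /orP[]/eqP; [left | right].
have [_ _ _ cl] := match_ab.
rewrite add0n; apply: (IH t.+1 I a b); [lia|by []| |].
- by move=> i iI; apply: (stepU _ Blue _ (b i)); [| case: (cl i iI) | exact: Ra | exact: Rb].
- move=> i iI; apply: (stepU _ Red _ (a i)); [| by case: (cl i iI) | exact: Rb | exact: Ra].
  by case: nilW; [right | left].
Qed.

(** A slot [t] of [G] matches the red and the blue packet scheduled in it. Both arrived between
    [t - T] and [t], so their arrival slots differ by at most [T]; the previous bound applies from
    slot 0. *)
Lemma matched_optimal T w N G : uniq G -> {in G, forall t, (t < N)%N} ->
  schedulable T (w Red) G -> schedulable T (w Blue) G -> (size G <= matched T w N)%N.
Proof.
move=> uG ltN [a ia Ra] [b ib Rb]; rewrite /matched -(big_mkord xpredT (fun t => nat_of_bool (paired T Link1 w t))).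
apply: (@matched_optimal_from T w N 0 G a b).
- split=> // t tG; have [_ at_ ta] := Ra t tG; have [_ bt tb] := Rb t tG; lia.
- by move=> t tG; right; have [wt at_ _] := Ra t tG; split=> //; exact: leq_ltn_trans at_ (ltN t tG).
- by move=> t tG; right; have [wt bt _] := Rb t tG; split=> //; exact: leq_ltn_trans bt (ltN t tG).
Qed.

(** * Locality, concatenation of schedules and superadditivity *)

Lemma paired_local T l w w' t : (forall c s, (s <= t)%N -> w c s = w' c s) ->
  paired T l w t = paired T l w' t.
Proof. by move=> eqw; rewrite -!(matching_sent_some _ _ _ Red) (sent_local _ _ _ eqw). Qed.

Lemma matched_local T w w' N : (forall c s, (s < N)%N -> w c s = w' c s) ->
  matched T w N = matched T w' N.
Proof.
move=> eqw; apply: eq_bigr => t _; congr (nat_of_bool _); apply: paired_local => c s st.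
by apply: eqw; exact: leq_ltn_trans st (ltn_ord t).
Qed.

Lemma matching_link T l l' w t : backlog (matching_rule T) l w t =1 backlog (matching_rule T) l' w t.
Proof.
elim: t => // t IH c /=.
have eqa e : arrive w t (backlog (matching_rule T) l w t) e =
  arrive w t (backlog (matching_rule T) l' w t) e by rewrite /arrive IH.
by rewrite /act !eqa.
Qed.

Lemma paired_link T l w t : paired T l w t = paired T Link1 w t.
Proof. by rewrite /paired /waiting /arrive !(matching_link T l Link1). Qed.

Lemma sum_bool_iota (p : pred nat) N :
  (\sum_(t < N) p t = size [seq t <- iota 0 N | p t])%N.
Proof.
rewrite size_filter -sum1_count [RHS]big_mkcond.
rewrite -(big_mkord xpredT (fun t => nat_of_bool (p t))) /index_iota subn0.
by apply: eq_bigr => t _; case: (p t).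
Qed.

Definition paired_slots T w N : seq nat := [seq t <- iota 0 N | paired T Link1 w t].

Lemma size_paired_slots T w N : size (paired_slots T w N) = matched T w N.
Proof. by rewrite /matched (sum_bool_iota (paired T Link1 w)). Qed.

Lemma schedulable_cat T (v : nat -> bool) M G H :
  {in G, forall t, (t < M)%N} -> schedulable T v G ->
  schedulable T (fun t => v (M + t)%N) H ->
  schedulable T v (G ++ [seq (M + t)%N | t <- H]).
Proof.
move=> ltM [a ia va] [b ib vb].
have inl t : t \in G ++ [seq (M + t)%N | t <- H] -> (t < M)%N -> t \in G.
  by rewrite mem_cat => /orP[//|/mapP[s _ ->]]; lia.
have inr t : t \in G ++ [seq (M + t)%N | t <- H] -> (M <= t)%N -> (t - M)%N \in H.
  rewrite mem_cat => /orP[/ltM|/mapP[s sH ->]]; first lia.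
  by rewrite addKn.
(* The blocks use disjoint packets: the first one those arriving before [M], the second one those
   from [M] on. *)
exists (fun t => if (t < M)%N then a t else M + b (t - M))%N.
  move=> s t sG tG; case: ltnP => sM; case: ltnP => tM.
  - by apply: ia; exact: inl.
  - by have [_ + _] := va _ (inl _ sG sM); lia.
  - by have [_ + _] := va _ (inl _ tG tM); lia.
  - move/addnI/ib => /(_ (inr _ sG sM) (inr _ tG tM)); lia.
move=> t tG; case: ltnP => tM; first exact: va (inl _ tG tM).
by have [] := vb _ (inr _ tG tM); split=> //; lia.
Qed.

Lemma paired_slots_schedulable T w c N : schedulable T (w c) (paired_slots T w N).
Proof.
apply: (@sent_schedulable T (matching_rule T) Link1 w c).
  exact: matching_respects_delay.
by move=> t; rewrite mem_filter matching_sent_some => /andP[].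
Qed.

(** Running the rule on the first [M] slots and afresh, from empty queues, on the next [N] yields
    one schedule valid for both flows over [M + N] slots; optimality bounds its size. *)
Lemma matched_superadditive T w M N :
  (matched T w M + matched T (fun c t => w c (M + t)%N) N <= matched T w (M + N))%N.
Proof.
rewrite -!(size_paired_slots _ _ M, size_paired_slots _ _ N).
rewrite -(size_map (addn M) (paired_slots T _ N)) -size_cat.
have ltM : {in paired_slots T w M, forall t, (t < M)%N}.
  by move=> t; rewrite mem_filter mem_iota add0n => /andP[_].
have ltN v : {in paired_slots T v N, forall t, (t < N)%N}.
  by move=> t; rewrite mem_filter mem_iota add0n => /andP[_].
apply: matched_optimal.
- rewrite cat_uniq (map_inj_uniq (@addnI M)) !filter_uniq ?iota_uniq //= andbT.
  by apply/hasPn => _ /mapP[t _ ->]; apply/negP => /ltM; lia.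
- by move=> t; rewrite mem_cat => /orP[/ltM|/mapP[s /ltN ? ->]]; lia.
- by apply: schedulable_cat => //; exact: paired_slots_schedulable.
- by apply: schedulable_cat => //; exact: paired_slots_schedulable.
Qed.

Lemma matched_le T w N : (matched T w N <= N)%N.
Proof. by rewrite -size_paired_slots size_filter (leq_trans (count_size _ _))// size_iota. Qed.

Lemma schedulable_local T (v v' : nat -> bool) N G : {in G, forall t, (t < N)%N} ->
  (forall s, (s < N)%N -> v s = v' s) -> schedulable T v G -> schedulable T v' G.
Proof.
move=> ltN eqv [a ia va]; exists a => // t tG.
have [vat le_at le_ta] := va t tG; split=> //.
by rewrite -eqv // (leq_ltn_trans le_at (ltN t tG)).
Qed.

(** Two runs with the same arrivals transmit in the same slots, one for flow [c] and the other for
    the opposite flow. These slots are therefore a schedule of both flows. The rules may differ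
    because the runs may have different seeds. *)
Lemma transmitted_le_matched T N (f f' : rule) l l' w w' c c' : c <> c' ->
  respects_delay T f l w -> respects_delay T f' l' w' ->
  (forall e s, (s < N)%N -> w e s = w' e s) ->
  (forall t, (t < N)%N -> isSome (sent f l w c t) = isSome (sent f' l' w' c' t)) ->
  (\sum_(t < N) isSome (sent f l w c t) <= matched T w N)%N.
Proof.
move=> cc' delay delay' eqw eqs.
pose G := [seq t <- iota 0 N | isSome (sent f l w c t)].
have ltN : {in G, forall t, (t < N)%N}.
  by move=> t; rewrite mem_filter mem_iota add0n => /andP[_].
rewrite (sum_bool_iota (fun t => isSome (sent f l w c t))) -/G.
have Gc : schedulable T (w c) G.
  by apply: (sent_schedulable delay) => t; rewrite mem_filter => /andP[].
have Gc' : schedulable T (w c') G.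
  apply: (@schedulable_local T (w' c') (w c') N G ltN) => [s sN|]; first by rewrite eqw.
  apply: (sent_schedulable delay') => t tG.
  by rewrite -eqs ?ltN//; move: tG; rewrite mem_filter => /andP[].
have uG : uniq G by rewrite filter_uniq// iota_uniq.
have fl (e e' : flow) : e <> e' -> (e = Red /\ e' = Blue) \/ (e = Blue /\ e' = Red).
  by case: e e' => [] [] // _; [left | right].
by case: (fl _ _ cc') => -[e e']; apply: matched_optimal => //; rewrite -?e -?e'.
Qed.

(** * Limits *)

(** The limit is the supremum of the ratios. Cutting [n] into blocks of a length whose ratio is
    nearly the supremum gives the lower bound, and nonnegativity discards the incomplete block. *)
Lemma fekete (R : realType) (u : nat -> R) :
  (forall n, 0 <= u n <= n%:R) -> (forall m n, u m + u n <= u (m + n)%N) ->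
  cvgn (fun n => u n / n%:R).
Proof.
move=> bnd sup; pose A := [set u n.+1 / n.+1%:R | n in setT].
have u0 n : 0 <= u n by case/andP: (bnd n).
have un n : u n <= n%:R by case/andP: (bnd n).
have A1 : ubound A 1.
  by move=> _ [n _ <-]; rewrite ler_pdivrMr ?ltr0n// mul1r.
have supA : has_sup A by split; [exists (u 1 / 1), 0%N | exists 1].
have aux (e N K v L' x : R) : K <= e / 2 * N -> v <= K ->
    (L' - e / 2) * N <= x -> (L' - e) * N <= x - v by lra.
have muln q k : q%:R * u k <= u (q * k)%N.
  elim: q => [|q IH]; first by rewrite mul0r.
  rewrite mulSn; apply: le_trans (sup _ _).
  by rewrite -addn1 natrD mulrDl mul1r addrC lerD2l.
apply/cvg_ex; exists (reals.sup A) => /=; apply/cvgrPdist_le => e e0.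
have e2 : 0 < e / 2 by rewrite divr_gt0.
have [_ [k _ <-] ltk] := sup_adherent e2 supA.
near=> n.
have n0 : (0 < n)%N by near: n; exists 1%N.
have nR : 0 < n%:R :> R by rewrite ltr0n.
have le_sup : u n / n%:R <= reals.sup A.
  by apply: (ub_le_sup supA.2); exists n.-1; rewrite ?prednK.
rewrite ger0_norm ?subr_ge0// lerBlDr -lerBlDl.
have kR : 0 < k.+1%:R :> R by rewrite ltr0n.
(* One [e / 2] is spent on approaching the supremum by block length [k.+1]; the other absorbs the
   incomplete block, which is negligible for large [n]. *)
have nk : k.+1%:R <= e / 2 * n%:R.
  rewrite mulrC -ler_pdivrMr//; near: n; exact: nbhs_infty_ger.
have le1 : (n %/ k.+1)%:R * u k.+1 <= u n.
  apply: le_trans (muln _ _) _; rewrite {2}(divn_eq n k.+1).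
  by apply: le_trans (sup _ _); rewrite lerDl.
have le2 : n%:R <= (n %/ k.+1)%:R * k.+1%:R + k.+1%:R :> R.
  rewrite {1}(divn_eq n k.+1) natrD natrM lerD2l ler_nat.
  by rewrite ltnW// ltn_mod.
rewrite ler_pdivlMr//; set v := u k.+1 in ltk le1; set L := reals.sup A in ltk *.
set K := k.+1%:R in ltk kR nk le2; set q := (_ %/ _)%:R in le1 le2.
have vK : v <= K by exact: un.
have ltk' : L - e / 2 <= v / K by exact: ltW.
apply: le_trans le1.
have le3 : v / K * (n%:R - K) <= q * v.
  have -> : q * v = v / K * (q * K) by field; rewrite gt_eqF.
  by apply: ler_wpM2l; [rewrite divr_ge0 ?u0// ltW | rewrite lerBlDr].
apply: le_trans le3; rewrite mulrBr divfK ?gt_eqF//.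
apply: aux nk vK _; exact: (ler_wpM2r (ltW nR) ltk').
Unshelve. all: by end_near. Qed.

Lemma le_limn_esup (R : realType) (u v : (\bar R)^nat) :
  (forall n, u n <= v n)%E -> (limn_esup u <= limn_esup v)%E.
Proof.
move=> le_uv; rewrite !limn_esup_lim.
apply: lee_lim; [exact: is_cvg_esups|exact: is_cvg_esups|].
apply: nearW => n; apply: ub_ereal_sup => _ [k nk <-].
by apply: le_trans (le_uv k) _; apply: ereal_sup_ubound; exists k.
Qed.

(** * Finitely and countably valued random variables *)

Section Fibers.
Context d (Omega : measurableType d).

(* Measurability with respect to the discrete sigma-algebra on a countable
   codomain. *)
Definition fiberwise_measurable (C : Type) (f : Omega -> C) : Prop :=
  forall c, measurable [set x | f x = c].

Lemma fiberwise_measurable_cst (C : Type) (e : C) : fiberwise_measurable (fun=> e).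
Proof.
move=> c; have [->|ne] := pselect (e = c).
  by rewrite (_ : [set _ | _] = setT) //; apply/seteqP.
by rewrite (_ : [set _ | _] = set0) //; apply/seteqP; split.
Qed.

(** Splitting over the countably many values of [f] freezes the argument [c], while [g c] may still
    depend on [x] through uncountable data such as the seed. *)
Lemma fiberwise_measurable_bind (C : countType) (E : Type) (f : Omega -> C)
    (g : C -> Omega -> E) : fiberwise_measurable f ->
  (forall c, fiberwise_measurable (g c)) -> fiberwise_measurable (fun x => g (f x) x).
Proof.
move=> mf mg e.
rewrite (_ : [set x | _] = \bigcup_c ([set x | f x = c] `&` [set x | g c x = e])).
  apply: countable_bigcupT_measurable; first exact: countableP.
  by move=> c; apply: measurableI; [exact: mf | exact: mg].
by apply/seteqP; split=> [x /= <-|x [c _ [/= <-]]//]; exists (f x).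
Qed.

Lemma fiberwise_measurable_comp (C : countType) (E : Type) (f : Omega -> C)
    (g : C -> E) : fiberwise_measurable f -> fiberwise_measurable (fun x => g (f x)).
Proof.
move=> mf; apply: (@fiberwise_measurable_bind C E f (fun c _ => g c) mf) => c.
exact: fiberwise_measurable_cst.
Qed.

Lemma fiberwise_measurable_pair (C E : countType) (f : Omega -> C) (g : Omega -> E) :
  fiberwise_measurable f -> fiberwise_measurable g ->
  fiberwise_measurable (fun x => (f x, g x)).
Proof.
move=> mf mg; apply: (@fiberwise_measurable_bind C _ f (fun c x => (c, g x)) mf) => c.
exact: (@fiberwise_measurable_comp _ _ g (pair c) mg).
Qed.

Lemma fiberwise_measurable_tuple (E : countType) N (f : 'I_N -> Omega -> E) :
  (forall t, fiberwise_measurable (f t)) ->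
  fiberwise_measurable (fun x => [tuple f t x | t < N]).
Proof.
move=> mf v; rewrite (_ : [set x | _] = \bigcap_t [set x | f t x = tnth v t]).
  by apply: fin_bigcap_measurable => // t _; exact: mf.
apply/seteqP; split=> [x /= <- t _|x fx] /=; first by rewrite tnth_mktuple.
by apply: eq_from_tnth => t; rewrite tnth_mktuple fx.
Qed.

Context (R : realType) (P : probability Omega R).

Lemma expectation_finite (F : finType) (Y : Omega -> F) (h : F -> R) :
  fiberwise_measurable Y -> (forall v, 0 <= h v) ->
  ('E_P[fun x => h (Y x)])%E = (\sum_v h v * fine (P [set x | Y x = v]))%:E.
Proof.
move=> mY h0; rewrite unlock.
transitivity (\int[P]_x \sum_(v <- index_enum F) (h v * \1_([set x | Y x = v]) x)%:E)%E.
  apply: eq_integral => x _; rewrite sumEFin; congr EFin.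
  rewrite (bigD1 (Y x)) //= big1 ?addr0; last first.
    move=> v vY; rewrite indicE memNset ?mulr0//= => e.
    by rewrite e eqxx in vY.
  by rewrite indicE mem_set ?mulr1.
rewrite ge0_integral_sum //; last 2 first.
- move=> v; apply/measurable_EFinP; apply: measurable_funM => //.
- by move=> v x _; rewrite lee_fin mulr_ge0.
rewrite -sumEFin; apply: eq_bigr => v _.
rewrite (integralZl_indic measurableT (fun=> [set x | Y x = v])) //; last first.
  by move/(le_lt_trans (h0 v)); rewrite ltxx.
by rewrite integral_indic // setIT EFinM fineK // fin_num_measure.
Qed.

Lemma probability_finite (F : finType) (Y : Omega -> F) (Q : pred F) :
  fiberwise_measurable Y ->
  fine (P [set x | Q (Y x)]) = \sum_(v | Q v) fine (P [set x | Y x = v]).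
Proof.
move=> mY; have := @expectation_finite F Y (fun v => (Q v)%:R) mY (fun v => ler0n _ _).
have mQ : measurable [set x | Q (Y x)] by exact: (fiberwise_measurable_comp Q mY).
have -> : (fun x => (Q (Y x))%:R) = \1_([set x | Q (Y x)]) :> (Omega -> R).
  by apply/funext => x; rewrite indicE; congr (nat_of_bool _)%:R; apply/idP/idP; rewrite inE.
rewrite unlock integral_indic // setIT => -> /=.
by rewrite [RHS]big_mkcond; apply: eq_bigr => v _; case: (Q v); rewrite ?mul1r ?mul0r.
Qed.

End Fibers.

(** * Conditional entropy *)

Lemma ln_le_subr1 (R : realType) (x : R) : 0 < x -> ln x <= x - 1.
Proof.
move=> x0; have := @le_ln1Dx R (x - 1); rewrite (addrC 1) subrK; apply.
by rewrite ltrBrDr addNr.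
Qed.

Lemma ln_eq_subr1 (R : realType) (x : R) : 0 < x -> ln x = x - 1 -> x = 1.
Proof.
move=> x0 lnx; apply/eqP/negPn/negP => x1.
have := @expR_gt1Dx R (x - 1); rewrite -{3}lnx lnK ?posrE// (addrC 1) subrK ltxx.
by rewrite subr_eq0 => /(_ x1).
Qed.

Section Gibbs.
Context (R : realType).
Implicit Types p s r : R.

(** This is [ln y <= y - 1] at [y = s * r / p], multiplied by [p]. Here [p] is a joint probability,
    [s] the marginal and [r] a reference conditional probability; the linear terms [p - s * r]
    cancel upon summation. *)
Lemma gibbs p s r : 0 <= p -> p <= s -> (0 < p -> 0 < r) -> 0 <= r ->
  p * ln r + p - s * r <= p * ln (p / s).
Proof.
move=> p0 ps r_gt0 r0; have [->|p_neq0] := eqVneq p 0.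
  by rewrite !mul0r addr0 sub0r oppr_le0 mulr_ge0// (le_trans p0).
have p_gt0 : 0 < p by rewrite lt_neqAle eq_sym p_neq0.
have {}r_gt0 := r_gt0 p_gt0; have s_gt0 := lt_le_trans p_gt0 ps.
have := ler_wpM2l p0 (ln_le_subr1 (divr_gt0 (mulr_gt0 s_gt0 r_gt0) p_gt0)).
rewrite !(ln_div, lnM) ?posrE ?mulr_gt0//.
have -> : p * (s * r / p - 1) = s * r - p by field.
lra.
Qed.

(** Equality in [ln y <= y - 1] forces [y = 1]. *)
Lemma gibbs_eq p s r : 0 <= p -> p <= s -> 0 < r ->
  p * ln (p / s) <= p * ln r + p - s * r -> p = s * r.
Proof.
move=> p0 ps r0; have [->|p_neq0] := eqVneq p 0.
  rewrite !mul0r addr0 sub0r oppr_ge0 => sr; apply/eqP.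
  by rewrite eq_le sr andbT; apply: mulr_ge0; [exact: le_trans p0 ps | exact: ltW].
have p_gt0 : 0 < p by rewrite lt_neqAle eq_sym p_neq0.
have s_gt0 := lt_le_trans p_gt0 ps => le1.
have x0 : 0 < s * r / p by rewrite divr_gt0 ?mulr_gt0.
suff /(ln_eq_subr1 x0) eq1 : ln (s * r / p) = s * r / p - 1.
  by rewrite -[LHS]mul1r -eq1 divfK.
apply/eqP; rewrite eq_le ln_le_subr1//= -(ler_pM2l p_gt0).
have -> : p * (s * r / p - 1) = s * r - p by field.
move: le1; rewrite !(ln_div, lnM) ?posrE ?mulr_gt0//; lra.
Qed.

End Gibbs.

Section Entropy.
Context d (Omega : measurableType d) (R : realType) (P : probability Omega R).
Context (TA TB : finType) (A : Omega -> TA) (B : Omega -> TB).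
Hypotheses (mA : fiberwise_measurable A) (mB : fiberwise_measurable B).

Local Notation joint a b := (fine (P [set x | A x = a /\ B x = b])).
Local Notation marginal b := (fine (P [set x | B x = b])).

Lemma ln2_gt0 : 0 < ln 2 :> R.
Proof. by apply: ln_gt0; rewrite ltr1n. Qed.

Lemma cond_entropy_ln : cond_entropy P A B =
  - (\sum_b \sum_a joint a b * ln (joint a b / marginal b)) / ln 2.
Proof.
rewrite /cond_entropy mulNr; congr (- _); rewrite mulr_suml; apply: eq_bigr => b _.
by rewrite mulr_suml; apply: eq_bigr => a _; rewrite /log2 mulrA.
Qed.

Lemma joint_sum (a : TA) (Q : pred TB) :
  fine (P [set x | A x = a /\ Q (B x)]) = \sum_(b | Q b) joint a b.
Proof.
have := probability_finite P (fun v : TA * TB => (v.1 == a) && Q v.2)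
  (fiberwise_measurable_pair mA mB).
rewrite (_ : [set x | _] = [set x | A x = a /\ Q (B x)]); last first.
  by apply/seteqP; split=> x /= [] => [/andP[/eqP]|-> ->]; rewrite ?eqxx.
move=> ->; transitivity (\sum_(v : TA * TB | (v.1 == a) && Q v.2) joint v.1 v.2).
  by apply: eq_bigr => -[a' b] _; congr (fine (P _)); apply/seteqP; split=> x /= [-> ->].
by rewrite -(pair_big (pred1 a) Q (fun a b => joint a b)) /= big_pred1_eq.
Qed.

Lemma joint_marginal b : marginal b = \sum_a joint a b.
Proof.
have := probability_finite P (fun v : TA * TB => v.2 == b)
  (fiberwise_measurable_pair mA mB).
rewrite (_ : [set x | _] = [set x | B x = b]); last first.
  by apply/seteqP; split=> x /= /eqP.
move=> ->; transitivity (\sum_(v : TA * TB | v.2 == b) joint v.1 v.2).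
  by apply: eq_bigr => -[a b'] _; congr (fine (P _)); apply/seteqP; split=> x /= [-> ->].
rewrite -(pair_big predT (pred1 b) (fun a b => joint a b)) /=.
by apply: eq_bigr => a _; rewrite big_pred1_eq.
Qed.

Lemma joint_ge0 a b : 0 <= joint a b.
Proof. exact: fine_ge0. Qed.

Lemma joint_le a b : joint a b <= marginal b.
Proof.
by rewrite joint_marginal (bigD1 a)//= lerDl sumr_ge0// => a' _; exact: joint_ge0.
Qed.

Lemma marginal_total : \sum_b marginal b = 1.
Proof.
rewrite -(probability_finite P predT mB) (_ : [set x | _] = setT); last exact/seteqP.
by rewrite probability_setT.
Qed.

(* Gibbs' inequality against the uniform conditional distribution. *)
Lemma cond_entropy_max : (0 < #|TA|)%N -> ln #|TA|%:R / ln 2 <= cond_entropy P A B ->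
  forall a b, joint a b = marginal b / #|TA|%:R.
Proof.
set n := #|TA|; move=> n0; rewrite cond_entropy_ln ler_pM2r ?invr_gt0 ?ln2_gt0// => le1.
have nR : 0 < n%:R :> R by rewrite ltr0n.
have rR : 0 < n%:R^-1 :> R by rewrite invr_gt0.
(* [D] is the termwise defect in Gibbs' inequality with reference [1 / n]. All defects are
   nonnegative, and the entropy hypothesis makes their sum nonpositive, so each vanishes. *)
pose D a b := joint a b * ln (joint a b / marginal b) -
  (joint a b * ln n%:R^-1 + joint a b - marginal b * n%:R^-1).
have D0 a b : 0 <= D a b.
  by rewrite subr_ge0 gibbs ?joint_ge0 ?joint_le// ltW.
have DT : \sum_b \sum_a D a b = 0.
  apply/eqP; rewrite eq_le sumr_ge0 ?andbT; last by move=> b _; apply: sumr_ge0.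
  have -> : \sum_b \sum_a D a b =
      \sum_b \sum_a joint a b * ln (joint a b / marginal b) + ln n%:R.
    have -> : ln n%:R = \sum_b ln n%:R * marginal b :> R.
      by rewrite -mulr_sumr marginal_total mulr1.
    rewrite -big_split; apply: eq_bigr => b _ /=.
    rewrite /D sumrB; congr (_ + _); rewrite sumrB big_split /= -mulr_suml -joint_marginal.
    rewrite sumr_const -[_ *+ #|_|]mulr_natr divfK ?gt_eqF//.
    by rewrite lnV ?posrE// addrK mulrN opprK mulrC.
  by rewrite -lerBrDr sub0r -lerN2 opprK.
move=> a b; apply: gibbs_eq => //; [exact: joint_ge0|exact: joint_le|].
have Db0 : \sum_a D a b = 0.
  by apply: (psumr_eq0P _ DT) => // b' _; apply: sumr_ge0.
by rewrite -subr_le0 -/(D a b) (psumr_eq0P _ Db0).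
Qed.

(** On each fibre of [g], Gibbs' inequality is applied with the conditional law of [A] given the
    coarser observation as reference (the log-sum inequality). *)
Lemma cond_entropy_coarsen (TB' : finType) (g : TB -> TB') :
  cond_entropy P A B <= cond_entropy P A (fun x => g (B x)).
Proof.
rewrite cond_entropy_ln /cond_entropy.
have -> : \sum_(b : TB') \sum_(a : TA)
    (let pab := fine (P [set x | A x = a /\ g (B x) = b]) in
     let pb := fine (P [set x | g (B x) = b]) in pab * log2 (pab / pb)) =
  (\sum_b' \sum_a (\sum_(b | g b == b') joint a b) *
    ln ((\sum_(b | g b == b') joint a b) / \sum_(b | g b == b') marginal b)) / ln 2.
  rewrite mulr_suml; apply: eq_bigr => b' _; rewrite mulr_suml; apply: eq_bigr => a _ /=.
  rewrite -(joint_sum a (fun b => g b == b')) -(probability_finite P (fun b => g b == b') mB).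
  have -> : [set x | g (B x) = b'] = [set x | g (B x) == b'].
    by apply/seteqP; split=> x /= /eqP.
  have -> : [set x | A x = a /\ g (B x) = b'] = [set x | A x = a /\ g (B x) == b'].
    by apply/seteqP; split=> x /= [-> /eqP].
  by rewrite /log2 mulrA.
rewrite mulNr lerN2 ler_pM2r ?invr_gt0 ?ln2_gt0//.
rewrite [leRHS](partition_big g predT) //=; apply: ler_sum => b' _.
rewrite exchange_big; apply: ler_sum => a _ /=.
set U := \sum_(b | _) joint a b; set V := \sum_(b | _) marginal b.
have U0 : 0 <= U by apply: sumr_ge0 => b _; exact: joint_ge0.
have UV : U <= V by apply: ler_sum => b _; exact: joint_le.
have V0 := le_trans U0 UV.
(* The reference is [r = U / V]; the corrections sum to [U - V * (U / V) = 0], also when [V = 0],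
   since then [U = 0]. *)
apply: (@le_trans _ _ (\sum_(b | g b == b')
    (joint a b * ln (U / V) + joint a b - marginal b * (U / V)))).
  rewrite sumrB big_split /= -!mulr_suml -/U -/V.
  have -> : V * (U / V) = U.
    have [V_eq0|V_neq0] := eqVneq V 0; last by field.
    by rewrite V_eq0 mul0r; apply/eqP; rewrite eq_le U0 -V_eq0 UV.
  by rewrite addrK.
apply: ler_sum => b gb; apply: gibbs; rewrite ?joint_ge0 ?joint_le ?divr_ge0//.
move=> p0; have U_gt0 : 0 < U.
  apply: lt_le_trans p0 _; rewrite /U (bigD1 b)//= lerDl.
  by apply: sumr_ge0 => b2 _; exact: joint_ge0.
by rewrite divr_gt0// (lt_le_trans U_gt0).
Qed.

End Entropy.

(** * The probabilistic model *)

Lemma mutually_independent_finite d (Omega : measurableType d) (R : realType)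
    (P : probability Omega R) (I : Type) (F : I -> set (set Omega)) (J : finType)
    (i : J -> I) (E : J -> set Omega) : mutually_independent P F -> injective i ->
  (forall j, F (i j) (E j)) -> P (\bigcap_j E j) = (\prod_(j : J) P (E j))%E.
Proof.
move=> indep inj_i FE.
have inj_e : injective (fun k : 'I_#|J| => i (enum_val k)).
  by move=> k k' /inj_i/enum_val_inj.
have := indep _ _ inj_e (fun k => E (enum_val k)) (fun k => FE _).
have -> : \bigcap_(k : 'I_#|J|) E (enum_val k) = \bigcap_j E j.
  apply/seteqP; split=> x Ex k _; last exact: Ex.
  by have := Ex (enum_rank k) Logic.I; rewrite enum_rankK.
by move=> ->; rewrite [RHS](reindex (@enum_val J J)) //; exact/onW_bij/enum_val_bij.
Qed.

(** Indexes the flows by a finite type, for products over ['I_N * bool]. *)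
Definition flow_of (b : bool) : flow := if b then Red else Blue.

Definition word (Omega S : Type) (X : mix_inputs Omega S) (s N : nat) (x : Omega) :
    N.-tuple bool * N.-tuple bool :=
  ([tuple arrival X Red (s + t)%N x | t < N], [tuple arrival X Blue (s + t)%N x | t < N]).

(** Reads a finite word as an infinite arrival pattern with no arrivals beyond the horizon; by
    causality the padding does not affect the first [N] slots. *)
Definition of_word N (v : N.-tuple bool * N.-tuple bool) (c : flow) (t : nat) : bool :=
  nth false (if c is Red then v.1 else v.2) t.

Lemma of_wordE (Omega S : Type) (X : mix_inputs Omega S) s N x c t : (t < N)%N ->
  of_word (word X s N x) c t = arrival X c (s + t)%N x.
Proof. by move=> tN; case: c; exact: (nth_mktuple _ _ (Ordinal tN)). Qed.

Section Model.
Context (R : realType) (lambda : flow -> R) d (Omega : measurableType d)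
  (P : probability Omega R) d' (S : measurableType d') (X : mix_inputs Omega S).
Hypothesis hX : mix_model P lambda X.

Lemma arrival_measurable c t : fiberwise_measurable (arrival X c t).
Proof. by move=> b; apply: (source_measurable hX (i := Arrival c t)) ; exists [set b]. Qed.

Lemma red_link_measurable : fiberwise_measurable (red_link X).
Proof. by move=> l; apply: (source_measurable hX (i := Destination)); exists [set l]. Qed.

Lemma seed_measurable (B : set S) : measurable B -> measurable [set x | B (seed X x)].
Proof. by move=> mB; apply: (source_measurable hX (i := Seed)); exists B. Qed.

Lemma word_measurable s N : fiberwise_measurable (word X s N).
Proof.
by apply: fiberwise_measurable_pair; apply: fiberwise_measurable_tuple => t;
  exact: arrival_measurable.
Qed.

Definition word_probability N (v : N.-tuple bool * N.-tuple bool) : \bar R :=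
  (\prod_(j : 'I_N * bool)
    (if of_word v (flow_of j.2) j.1 then lambda (flow_of j.2)
     else 1 - lambda (flow_of j.2))%:E)%E.

(** The right-hand side does not involve [s] and is a product, so this gives both stationarity of
    the arrivals and their independence of the destination. *)
Lemma word_law s N v (B : set link) :
  P [set x | word X s N x = v /\ B (red_link X x)] =
  (word_probability v * P [set x | B (red_link X x)])%E.
Proof.
(* The index type lists the [2 * N] arrival indicators and, as [inr tt], the destination, so that
   independence applies to all of them at once. *)
pose i (j : 'I_N * bool + unit) : source :=
  if j is inl k then Arrival (flow_of k.2) (s + k.1) else Destination.
pose E (j : 'I_N * bool + unit) : set Omega :=
  if j is inl k then [set x | arrival X (flow_of k.2) (s + k.1) x = of_word v (flow_of k.2) k.1]
  else [set x | B (red_link X x)].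
have inj_i : injective i.
  move=> [[t b]|[]] [[u b']|[]] //= [eb et]; congr (inl (_, _)).
    exact: val_inj (addnI et).
  by case: b b' eb => [] [].
have FE j : source_events X (i j) (E j).
  case: j => [[t b]|[]] /=; last by exists B.
  by exists [set of_word v (flow_of b) t].
have := mutually_independent_finite (source_independent hX) inj_i FE.
rewrite big_sumType /= (big_pred1 tt) //.
have -> : \bigcap_j E j = [set x | word X s N x = v /\ B (red_link X x)].
  apply/seteqP; split=> [x Ex|x [xv Bx] [[t b]|[]] _] /=; last by [].
    split; last exact: (Ex (inr tt)).
    rewrite [RHS]surjective_pairing; congr (_, _); apply: eq_from_tnth => t; rewrite tnth_mktuple.
      by have /= := Ex (inl (t, true)) Logic.I; rewrite /of_word -tnth_nth.
    by have /= := Ex (inl (t, false)) Logic.I; rewrite /of_word -tnth_nth.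
  by rewrite -xv of_wordE.
move=> ->; congr (_ * _)%E; apply: eq_bigr => -[t b] _ /=.
case: (of_word v _ t); first by rewrite (arrival_rate hX).
rewrite EFinB -(arrival_rate hX _ (s + t)%N) -probability_setC.
  by congr (P _); apply/seteqP; split=> x /= => [->|/negP/negbTE].
exact: arrival_measurable.
Qed.

Lemma word_stationary s N v : P [set x | word X s N x = v] = P [set x | word X 0 N x = v].
Proof.
have E r : [set x | word X r N x = v] = [set x | word X r N x = v /\ [set: link] (red_link X x)].
  by apply/seteqP; split=> x //= [].
by rewrite E [in RHS]E !word_law.
Qed.

Lemma word_link N v l :
  P [set x | word X 0 N x = v /\ red_link X x = l] =
  (P [set x | word X 0 N x = v] * (2^-1)%:E)%E.
Proof.
rewrite (word_law 0 v [set l]) (red_link_uniform hX); congr (_ * _)%E.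
have -> : [set x | word X 0 N x = v] = [set x | word X 0 N x = v /\ [set: link] (red_link X x)].
  by apply/seteqP; split=> x //= [].
rewrite word_law (_ : [set x | _] = setT); last by apply/seteqP.
by rewrite probability_setT mule1.
Qed.

End Model.

(** * Measurability of queues, transmissions and observations *)

Section ObservationMeasurable.
Context (R : realType) (lambda : flow -> R) d (Omega : measurableType d)
  (P : probability Omega R) d' (S : measurableType d') (X : mix_inputs Omega S).
Hypothesis hX : mix_model P lambda X.
Context (psi : S -> rule).
Hypothesis mpsi : measurable_strategy psi.

Local Notation "'run' F x" := (F (psi (seed X x)) (red_link X x) (realised X x))
  (at level 10, F at level 8, x at level 8).

(** As a pair, a decision lives in a countable type. *)
Let parts (D : decision) := (drops D, send D).

Lemma history_measurable t : fiberwise_measurable (fun x => history (realised X x) t).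
Proof.
rewrite /history; elim: (iota _ _) => [|s r IH] /=; first exact: fiberwise_measurable_cst.
apply: (fiberwise_measurable_comp (fun v : (bool * bool) * seq (bool * bool) => v.1 :: v.2)
  (f := fun x => ((arrival X Red s x, arrival X Blue s x), _))).
apply: fiberwise_measurable_pair => //.
by apply: fiberwise_measurable_pair; exact: (arrival_measurable hX).
Qed.

(** Once the link, the history and the two queues are fixed among countably many values, the
    decision depends on the seed alone, and [measurable_strategy] applies. *)
Lemma decision_measurable t c :
  (forall e, fiberwise_measurable (fun x => run waiting x t e)) ->
  fiberwise_measurable (fun x => parts (run act x t (run waiting x t) c)).
Proof.
move=> mW; pose f x :=
  (red_link X x, history (realised X x) t, run waiting x t Red, run waiting x t Blue).
pose g (v : link * seq (bool * bool) * seq nat * seq nat) x :=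
  parts (psi (seed X x) v.1.1.1 v.1.1.2 v.1.2 v.2 c).
apply: (@fiberwise_measurable_bind _ _ _ _ f g).
  apply: fiberwise_measurable_pair => //; apply: fiberwise_measurable_pair => //.
  by apply: fiberwise_measurable_pair; [exact: (red_link_measurable hX) | exact: history_measurable].
move=> [[[l h] qR] qB] [D b].
rewrite (_ : [set x | _] = [set x | [set s | psi s l h qR qB c = Decision D b] (seed X x)]).
  exact: (seed_measurable hX) (mpsi l h qR qB c _).
by apply/seteqP; split=> x; rewrite /g /parts /=; case: (psi _ _ _ _ _ _) => [D' b'] /= [-> ->].
Qed.

Lemma backlog_waiting_measurable t c :
  fiberwise_measurable (fun x => run backlog x t c) ->
  fiberwise_measurable (fun x => run waiting x t c).
Proof.
move=> mQ; apply: (fiberwise_measurable_comp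
  (fun v : bool * seq nat => if v.1 then rcons v.2 t else v.2)
  (f := fun x => (arrival X c t x, run backlog x t c))).
by apply: fiberwise_measurable_pair => //; exact: (arrival_measurable hX).
Qed.

Lemma backlog_measurable t c : fiberwise_measurable (fun x => run backlog x t c).
Proof.
elim: t c => [|t IH] c; first exact: fiberwise_measurable_cst.
have mW e := backlog_waiting_measurable (IH e).
have := fiberwise_measurable_comp
  (fun v : (seq nat * bool) * seq nat => remaining (Decision v.1.1 v.1.2) v.2)
  (fiberwise_measurable_pair (decision_measurable c mW) (mW c)).
by move=> h q; have := h q; congr measurable; apply/seteqP; split=> x /=;
  rewrite -/(waiting _ _ _ _); case: (act _ _ _ _ _ _).
Qed.

Lemma transmits_measurable t c : fiberwise_measurable (transmits X psi c t).
Proof.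
have mW e := backlog_waiting_measurable (backlog_measurable t e).
have := fiberwise_measurable_comp
  (fun v : (seq nat * bool) * seq nat => isSome (departing (Decision v.1.1 v.1.2) v.2))
  (fiberwise_measurable_pair (decision_measurable c mW) (mW c)).
by move=> h q; have := h q; congr measurable; apply/seteqP; split=> x /=;
  rewrite /transmits /sent; case: (act _ _ _ _ _ _).
Qed.

Lemma observation_measurable N : fiberwise_measurable (observation X psi N).
Proof.
have mout i t : fiberwise_measurable
    (fun x => output (psi (seed X x)) (red_link X x) (realised X x) i t).
  apply: (@fiberwise_measurable_bind _ _ _ _ (red_link X)
    (fun l x => transmits X psi (flow_on l i) t x) (red_link_measurable hX)) => l.
  exact: transmits_measurable.
apply: fiberwise_measurable_pair; first exact: (word_measurable hX 0).
by apply: fiberwise_measurable_pair; apply: fiberwise_measurable_tuple.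
Qed.

End ObservationMeasurable.

(** * Observed outputs and truncation to a shorter horizon *)

Definition link_for (l : link) (c : flow) : link :=
  match c, l with
  | Red, _ => l
  | Blue, Link1 => Link2
  | Blue, Link2 => Link1
  end.

Lemma flow_on_link_for l c : flow_on l (link_for l c) = c.
Proof. by case: l c => [] []. Qed.

Lemma flow_on_inj l l' i : l <> l' -> flow_on l i <> flow_on l' i.
Proof. by case: l l' i => [] [] // [] _; rewrite /flow_on /=. Qed.

Lemma card_link : #|{: link}| = 2%N.
Proof.
rewrite -card_bool; have linkK : cancel link_of_bool bool_of_link by case.
exact: (bij_eq_card (Bijective bool_of_linkK linkK)).
Qed.

Definition observed_output N (b : (N.-tuple bool * N.-tuple bool) * (N.-tuple bool * N.-tuple bool))
    (i : link) (t : 'I_N) : bool :=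
  tnth (if i is Link1 then b.2.1 else b.2.2) t.

Lemma observed_outputE d (Omega : measurableType d) (S : Type) (X : mix_inputs Omega S) (psi : S -> rule) N x i t :
  observed_output (observation X psi N x) i t =
  output (psi (seed X x)) (red_link X x) (realised X x) i t.
Proof. by case: i; rewrite /observed_output tnth_mktuple. Qed.

Definition truncate M N (v : M.-tuple bool) : N.-tuple bool :=
  [tuple nth false v t | t < N].

Definition truncate_observation M N
    (b : (M.-tuple bool * M.-tuple bool) * (M.-tuple bool * M.-tuple bool)) :
    (N.-tuple bool * N.-tuple bool) * (N.-tuple bool * N.-tuple bool) :=
  ((truncate N b.1.1, truncate N b.1.2), (truncate N b.2.1, truncate N b.2.2)).

Lemma truncate_mktuple M N (f : nat -> bool) : (N <= M)%N ->
  truncate N [tuple f t | t < M] = [tuple f t | t < N].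
Proof.
move=> NM; apply: eq_from_tnth => t; rewrite !tnth_mktuple.
exact: (nth_mktuple _ _ (widen_ord NM t)).
Qed.

Lemma truncate_observationE d (Omega : measurableType d) (S : Type) (X : mix_inputs Omega S) (psi : S -> rule) M N :
  (N <= M)%N -> observation X psi N = (fun x => truncate_observation N (observation X psi M x)).
Proof.
move=> NM; apply/funext => x; rewrite /observation /truncate_observation /=.
rewrite (truncate_mktuple (fun t => arrival X Red t x) NM).
rewrite (truncate_mktuple (fun t => arrival X Blue t x) NM).
by rewrite !(truncate_mktuple _ NM).
Qed.

(** * Anonymity and throughput of the matching rule against other strategies *)

Section Optimality.
Context (R : realType) (lambda : flow -> R) (T : nat) d (Omega : measurableType d)
  (P : probability Omega R) d' (S : measurableType d') (X : mix_inputs Omega S).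
Hypothesis hX : mix_model P lambda X.

Local Notation matching := (fun=> matching_rule T).

(** The entropy is nonincreasing in the horizon, so at each [N] it is at least its limit 1. This is
    the maximum for two links, attained only by the uniform conditional law. *)
Lemma perfect_anonymity (psi : S -> rule) N l b :
  measurable_strategy psi -> has_anonymity P X psi 1 ->
  fine (P [set x | red_link X x = l /\ observation X psi N x = b]) =
  fine (P [set x | observation X psi N x = b]) / 2.
Proof.
move=> mpsi anon; have mobs M := observation_measurable hX mpsi (N := M).
have mlink := red_link_measurable hX.
suff le1 : 1 <= cond_entropy P (red_link X) (observation X psi N).
  have := cond_entropy_max mlink (mobs N); rewrite card_link; apply=> //.
  by rewrite divff// gt_eqF// ln2_gt0.
apply: (@ler_cvg_to _ _ _ _ _ (fun=> cond_entropy P (red_link X) (observation X psi N)) _ _ anon).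
  exact: cvg_cst.
near=> M; rewrite (@truncate_observationE _ _ _ X psi M N).
  exact: (cond_entropy_coarsen P mlink (mobs M)).
by near: M; exists N.
Unshelve. all: by end_near. Qed.

(** Both links show the same slots, which the arrivals determine; the observation is thus a function
    of the arrival word alone, and the word is independent of the destination. *)
Definition matching_observation N (v : N.-tuple bool * N.-tuple bool) :=
  (v, ([tuple paired T Link1 (of_word v) t | t < N],
       [tuple paired T Link1 (of_word v) t | t < N])).

Lemma matching_observationE N x :
  observation X matching N x = matching_observation (word X 0 N x).
Proof.
have out i (t : 'I_N) : output (matching_rule T) (red_link X x) (realised X x) i t =
    paired T Link1 (of_word (word X 0 N x)) t.
  rewrite /output matching_sent_some paired_link; apply: paired_local => c s st.
  by rewrite of_wordE// (leq_ltn_trans st).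
by congr (_, (_, _)); apply: eq_from_tnth => t; rewrite !tnth_mktuple out.
Qed.

Lemma matching_cond_entropy N :
  cond_entropy P (red_link X) (observation X matching N) = 1.
Proof.
have mlink := red_link_measurable hX; have mword := word_measurable hX 0 (N := N).
have -> : observation X matching N = fun x => matching_observation (word X 0 N x).
  by apply/funext => x; exact: matching_observationE.
set B := fun x => _; have mB : fiberwise_measurable B.
  exact: (fiberwise_measurable_comp (@matching_observation N) mword).
have half a b : fine (P [set x | red_link X x = a /\ B x = b]) =
    fine (P [set x | B x = b]) * 2^-1.
  have -> : [set x | red_link X x = a /\ B x = b] =
      [set x | red_link X x = a /\ matching_observation (word X 0 N x) == b].
    by apply/seteqP; split=> x /= [-> /eqP].
  have -> : [set x | B x = b] = [set x | matching_observation (word X 0 N x) == b].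
    by apply/seteqP; split=> x /= /eqP.
  rewrite (joint_sum P mlink mword a (fun v => matching_observation v == b)).
  rewrite (probability_finite P (fun v => matching_observation v == b) mword).
  rewrite mulr_suml; apply: eq_bigr => v _.
  have -> : [set x | red_link X x = a /\ word X 0 N x = v] =
      [set x | word X 0 N x = v /\ red_link X x = a].
    by apply/seteqP; split=> x [].
  rewrite (word_link hX) fineM // fin_num_measure //; exact: mword.
rewrite cond_entropy_ln; under eq_bigr do under eq_bigr do rewrite half.
have ln2 := ln2_gt0 R.
have -> : \sum_b \sum_(a : link) fine (P [set x | B x = b]) * 2^-1 *
    ln (fine (P [set x | B x = b]) * 2^-1 / fine (P [set x | B x = b])) = - ln 2 :> R.
  rewrite -[RHS]mulr1 -[X in _ * X](marginal_total P mB) mulr_sumr; apply: eq_bigr => b _.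
  (* An observation of probability 0 contributes 0; otherwise, with probability [p], each of the two
     links contributes [p / 2 * ln (1 / 2)]. *)
  rewrite sumr_const card_link; have [->|p0] := eqVneq (fine (P [set x | B x = b])) 0.
    by rewrite !mul0r mulr0 mul0rn.
  rewrite [X in ln X]mulrAC divff// mul1r lnV ?posrE//.
  by rewrite -mulr_natr; field.
by rewrite opprK divff// gt_eqF.
Qed.

Lemma mean_output_matching c N : mean_output P X matching c N =
  ('E_P[fun x => ((matched T (realised X x) N)%:R / N%:R)%R])%E.
Proof.
congr expectation; apply/funext => x; rewrite /matched natr_sum; congr (_ / _).
by apply: eq_bigr => t _; rewrite /transmits matching_sent_some paired_link.
Qed.

Lemma matched_word s N M x : (N <= M)%N ->
  matched T (fun c t => arrival X c (s + t)%N x) N = matched T (of_word (word X s M x)) N.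
Proof.
by move=> NM; apply: matched_local => c t tN; rewrite of_wordE // (leq_trans tN).
Qed.

(** The expected number [u N] of pairs inherits superadditivity from the pathwise bound, thanks to
    stationarity of the arrivals. *)
Lemma mean_output_matching_cvg c : cvgn (mean_output P X matching c).
Proof.
have mword s N := word_measurable hX s (N := N).
pose pr N (v : N.-tuple bool * N.-tuple bool) := fine (P [set x | word X 0 N x = v]).
pose u N : R := \sum_v (matched T (of_word v) N)%:R * @pr N v.
(* Rewrites [u N] over any window of length [N] inside a common word of length [M], so that [u m],
   [u n] and [u (m + n)] can be compared word by word. *)
have uE s M N : (s + N <= M)%N -> u N =
    \sum_(v : M.-tuple bool * M.-tuple bool)
       (matched T (fun c t => of_word v c (s + t)%N) N)%:R * @pr M v.
  move=> sNM; apply: EFin_inj.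
  have := expectation_finite P (mword 0%N M)
    (fun v => ler0n R (matched T (fun c t => of_word v c (s + t)%N) N)).
  move=> <-.
  have := expectation_finite P (mword s N) (fun v => ler0n R (matched T (of_word v) N)).
  under [X in _ = X%:E]eq_bigr do rewrite (word_stationary hX).
  move=> <-; congr expectation; apply/funext => x; congr (_%:R).
  by apply: matched_local => e t tN; rewrite !of_wordE //; lia.
have u_sup m n : u m + u n <= u (m + n)%N.
  rewrite (uE 0%N (m + n)%N m) ?leq_addr// (uE m (m + n)%N n)// (uE 0%N (m + n)%N (m + n)%N)//.
  rewrite -big_split; apply: ler_sum => v _ /=.
  rewrite -mulrDl ler_wpM2r ?fine_ge0// -natrD ler_nat.
  exact: (matched_superadditive T (of_word v)).
have u_bnd n : 0 <= u n <= n%:R.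
  apply/andP; split; first by apply: sumr_ge0 => v _; rewrite mulr_ge0 ?fine_ge0.
  rewrite -[leRHS]mulr1 -[X in _ <= _ * X](marginal_total P (mword 0%N n)) mulr_sumr.
  by apply: ler_sum => v _; rewrite ler_wpM2r ?fine_ge0// ler_nat matched_le.
have /cvg_ex[l ul] := fekete u_bnd u_sup.
apply/cvg_ex; exists l%:E.
have -> : mean_output P X matching c = (fun n => (u n / n%:R)%:E).
  apply/funext => n; rewrite mean_output_matching mulr_suml.
  have h0 (v : n.-tuple bool * n.-tuple bool) : 0 <= (matched T (of_word v) n)%:R / n%:R :> R.
    by rewrite divr_ge0.
  under [in RHS]eq_bigr do rewrite mulrAC.
  rewrite -(expectation_finite P (mword 0%N n) h0); congr expectation; apply/funext => x.
  by rewrite -(@matched_word 0%N n n x).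
by apply: cvg_EFin => //; exact: nearW.
Qed.

(** Both means are sums over pairs of a link and an observation, with the same weights; they are
    compared term by term. *)
Lemma mean_output_le_matching (psi : S -> rule) c N :
  measurable_strategy psi -> meets_delay P X psi T -> has_anonymity P X psi 1 ->
  (mean_output P X psi c N <= mean_output P X matching c N)%E.
Proof.
move=> mpsi delay anon; have mobs := observation_measurable hX mpsi (N := N).
have mlink := red_link_measurable hX.
pose outcome : finType :=
  (link * ((N.-tuple bool * N.-tuple bool) * (N.-tuple bool * N.-tuple bool)))%type.
pose Y (x : Omega) : outcome := (red_link X x, observation X psi N x).
have mY : fiberwise_measurable Y := fiberwise_measurable_pair mlink mobs.
pose sends (v : outcome) : R :=
  (\sum_(t < N) (observed_output (N := N) v.2 (link_for v.1 c) t)%:R) / N%:R.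
pose pairs (v : outcome) : R :=
  (matched T (of_word v.2.1) N)%:R / N%:R.
have -> : mean_output P X psi c N = ('E_P[fun x => sends (Y x)])%E.
  congr expectation; apply/funext => x; congr (_ / _); apply: eq_bigr => t _.
  by rewrite observed_outputE /output flow_on_link_for.
have -> : mean_output P X matching c N = ('E_P[fun x => pairs (Y x)])%E.
  rewrite mean_output_matching; congr expectation; apply/funext => x.
  by rewrite /pairs -(@matched_word 0 N N x).
rewrite (expectation_finite P mY) => [|v]; last by rewrite divr_ge0// sumr_ge0.
rewrite (expectation_finite P mY) => [|v]; last by rewrite divr_ge0.
rewrite lee_fin; apply: ler_sum => -[l b] _.
have half e : fine (P [set x | Y x = (e, b)]) = fine (P [set x | observation X psi N x = b]) / 2.
  rewrite -(perfect_anonymity e b mpsi anon); congr (fine (P _)).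
  by apply/seteqP; split=> x; rewrite /Y /= => -[-> ->].
rewrite half; have [->|pb] := eqVneq (fine (P [set x | observation X psi N x = b])) 0.
  by rewrite mul0r !mulr0.
(* With link [e] and observation [b] the outcome has half the probability of [b], which is nonzero,
   so it is not contained in the null set where the delay constraint may fail. *)
have typical e : exists x, [/\ red_link X x = e, observation X psi N x = b &
    respects_delay T (psi (seed X x)) (red_link X x) (realised X x)].
  apply: contrapT => nox; have [Z [mZ PZ ZX]] := delay.
  have sub : [set x | Y x = (e, b)] `<=` Z.
    move=> x [xe xb]; apply: ZX => /= xdelay; apply: nox; exists x; split=> //.
  have := half e; rewrite (_ : P _ = 0%E) /=.
    by move/eqP; rewrite eq_sym mulf_eq0 (negPf pb) invr_eq0 pnatr_eq0.
  by apply: (subset_measure0 (mu := P)) sub PZ => //; exact: mY.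
apply: ler_wpM2r; first by rewrite divr_ge0// fine_ge0.
rewrite ler_wpM2r ?invr_ge0// -natr_sum ler_nat.
(* Under the opposite destination [l'], the output link [i] that serves [c] under [l] carries the
   other flow, while the observation [b] stays the same. *)
pose l' := if l is Link1 then Link2 else Link1.
have [x [xl xb xd]] := typical l; have [x' [xl' xb' xd']] := typical l'.
set i := link_for l c.
have realisedE y : observation X psi N y = b -> forall e s, (s < N)%N ->
    realised X y e s = of_word b.1 e s.
  by move=> <- e s sN; rewrite (@of_wordE _ _ X 0 N).
have -> : matched T (of_word b.1) N = matched T (realised X x) N.
  by apply: matched_local => e s sN; rewrite realisedE.
have outE y (t : 'I_N) : observation X psi N y = b -> observed_output b i t =
    isSome (sent (psi (seed X y)) (red_link X y) (realised X y) (flow_on (red_link X y) i) t).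
  by move=> <-; rewrite observed_outputE.
have -> : (\sum_(t < N) observed_output b i t = \sum_(t < N)
    isSome (sent (psi (seed X x)) (red_link X x) (realised X x) (flow_on (red_link X x) i) t))%N.
  by apply: eq_bigr => t _; rewrite (outE x).
apply: (transmitted_le_matched (c' := flow_on (red_link X x') i) _ xd xd').
- by rewrite xl xl'; apply: flow_on_inj; rewrite /l'; case: (l).
- by move=> e s sN; rewrite !realisedE.
- by move=> t tN; rewrite -(outE x (Ordinal tN) xb) -(outE x' (Ordinal tN) xb').
Qed.

End Optimality.

Theorem proposition2 (R : realType) (lambda : flow -> R) (T : nat)
    (hlambda : lambda Blue < lambda Red)
    (d : measure_display) (Omega : measurableType d) (P : probability Omega R)
    (d' : measure_display) (S : measurableType d') (X : mix_inputs Omega S)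
    (hX : mix_model P lambda X) :
  let matching : S -> rule := fun=> matching_rule T in
  [/\ meets_delay P X matching T,
      has_anonymity P X matching 1,
      forall c, cvgn (mean_output P X matching c) &
      forall psi : S -> rule, measurable_strategy psi ->
        meets_delay P X psi T -> has_anonymity P X psi 1 ->
        forall c, (throughput P X psi c <= throughput P X matching c)%E].
Proof.
move=> matching; split.
- by apply: aeW => x; exact: matching_respects_delay.
- rewrite /has_anonymity (_ : (fun N => _) = fun=> 1); first exact: cvg_cst.
  by apply/funext => N; exact: (matching_cond_entropy T hX).
- by move=> c; exact: (mean_output_matching_cvg hX).
- move=> psi mpsi delay anon c; apply: le_limn_esup => N.
  exact: (mean_output_le_matching hX).
Qed.
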